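(* Let $M>1$ be a real number and let $\alpha:(0,M)\to[0,\infty)$ be a log-concave function. Then the function \[ f(x)=\int_{0}^{M}\alpha(s)\binom{M}{s}(1-x)^{s}x^{M-s}\,ds \] is log-concave in $x$ on the interval $(0,1)$.
   Context: A non-negative function $h$ on an open interval $I$ is called log-concave if for all $x,y\in I$ and all $0<\lambda<1$, $h(\lambda x+(1-\lambda)y)\ge h(x)^{\lambda}h(y)^{1-\lambda}$. For real $a$ and $s$, the generalized binomial coefficient is $\binom{a}{s}=\frac{\Gamma(a+1)}{\Gamma(s+1)\Gamma(a-s+1)}$, where $\Gamma$ is the Gamma function; equivalently, for $0\le s\le M$, $\binom{M}{s}=\frac{1}{(M+1)B(s+1,M-s+1)}$ with $B$ the Beta function. *)

(* Defs.v *)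
From Stdlib Require Import Reals Lra Classical ClassicalEpsilon.
Open Scope R_scope.

(* Riemann integral of g over [a,b] as a total function: the Stdlib RiemannInt
   when g is Riemann integrable on [a,b], and 0 otherwise. *)
Definition Rint (g : R -> R) (a b : R) : R :=
  match excluded_middle_informative
          (exists v, exists pr : Riemann_integrable g a b, RiemannInt pr = v) with
  | left H => proj1_sig (constructive_indefinite_description _ H)
  | right _ => 0
  end.

(* Real power x^y for x >= 0, with the convention 0^y = 0 (used for y > 0). *)
Definition rpow (x y : R) : R :=
  if Req_EM_T x 0 then 0 else Rpower x y.

(* Beta function B(a,b) = int_0^1 t^(a-1) (1-t)^(b-1) dt (a, b >= 1 here). *)
Definition Beta (a b : R) : R :=
  Rint (fun t => rpow t (a - 1) * rpow (1 - t) (b - 1)) 0 1.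

(* Generalized binomial coefficient, for 0 <= s <= M:
   binom(M, s) = 1 / ((M+1) B(s+1, M-s+1)). *)
Definition binomR (M s : R) : R :=
  / ((M + 1) * Beta (s + 1) (M - s + 1)).

Definition log_concave_on (h : R -> R) (a b : R) : Prop :=
  (forall x, a < x < b -> 0 <= h x) /\
  (forall x y lam, a < x < b -> a < y < b -> 0 < lam < 1 ->
     h (lam * x + (1 - lam) * y) >= rpow (h x) lam * rpow (h y) (1 - lam)).

Definition integrand (alpha : R -> R) (M x : R) (s : R) : R :=
  alpha s * binomR M s * rpow (1 - x) s * rpow x (M - s).

Definition fM (alpha : R -> R) (M x : R) : R := Rint (integrand alpha M x) 0 M.

(* Main.v *)
Require Import Defs.
From Coquelicot Require Import Coquelicot.
From Stdlib Require Import Reals Lra Classical ClassicalEpsilon.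
Open Scope R_scope.

(** After differentiating twice, log-concavity of [f] says that a random variable [S] with density
    proportional to [w s = alpha s * binom M s * exp (t s)] has variance at most [E S (M - E S) / M].
    Writing [A], [B], [C] for the integrals of [s (s - 1)], [s (M - s)], [(M - s) (M - s - 1)]
    against [w], this is equivalent to [A C <= B^2].  If [A] and [C] are both negative, it follows
    from [- A <= B] and [- C <= B], which hold because [M >= 1].  If both are positive, discard the
    ranges where their integrands are negative; the recurrence
    [(s + 1) binom M (s + 1) = (M - s) binom M s] and a unit translation then turn the inequality
    into [h 1 * h (- 1) <= (h 0)^2] for [h z = int nu s * alpha (s + z) ds] with the log-concave
    weight [nu s = s (M - s) binom M s exp (t s)], that is, into the log-concavity of a
    convolution of log-concave functions. *)

(** * Real powers and the weighted AM-GM inequality *)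

Lemma rpow_0 (y : R) : rpow 0 y = 0.
Proof. unfold rpow; destruct (Req_EM_T 0 0); lra. Qed.

Lemma rpow_pos (x y : R) : 0 < x -> rpow x y = Rpower x y.
Proof. intros Hx; unfold rpow; destruct (Req_EM_T x 0); [lra|reflexivity]. Qed.

Lemma Rpower_gt_0 (x y : R) : 0 < Rpower x y.
Proof. apply exp_pos. Qed.

(** The tangent to [exp] at the weighted mean [m] of the logarithms lies below [exp]; when the
    tangent bounds at [ln x] and [ln y] are averaged, the linear terms cancel. *)
Lemma weighted_AM_GM (x y lam : R) : 0 < x -> 0 < y -> 0 < lam < 1 ->
  Rpower x lam * Rpower y (1 - lam) <= lam * x + (1 - lam) * y.
Proof.
  intros Hx Hy Hl. unfold Rpower. rewrite <- exp_plus.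
  set (m := lam * ln x + (1 - lam) * ln y).
  assert (T : forall u, 0 < u -> exp m * (1 + (ln u - m)) <= u).
  { intros u Hu. replace u with (exp m * exp (ln u - m)) at 2.
    - apply Rmult_le_compat_l; [left; apply exp_pos|].
      destruct (Req_dec (ln u - m) 0) as [E|E].
      + rewrite E, exp_0; lra.
      + left; now apply exp_ineq1.
    - rewrite <- exp_plus. replace (m + (ln u - m)) with (ln u) by ring.
      now apply exp_ln. }
  pose proof (T x Hx) as Tx; pose proof (T y Hy) as Ty.
  apply Rmult_le_compat_l with (r := lam) in Tx; [|lra].
  apply Rmult_le_compat_l with (r := 1 - lam) in Ty; [|lra].
  apply Rle_trans with (2 := Rplus_le_compat _ _ _ _ Tx Ty). right.
  replace (lam * (exp m * (1 + (ln x - m))) + (1 - lam) * (exp m * (1 + (ln y - m))))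
    with (exp m * (1 + (lam * ln x + (1 - lam) * ln y - m))) by ring.
  fold m; ring.
Qed.

(** * Log-concave functions *)

(** Since [rpow 0 _ = 0], the inequality is trivial as soon as [h] vanishes at one of the two
    points, so only positive values have to be treated. *)
Lemma log_concave_intro (h : R -> R) (a b : R) :
  (forall x, a < x < b -> 0 <= h x) ->
  (forall x y lam, a < x < b -> a < y < b -> 0 < lam < 1 -> 0 < h x -> 0 < h y ->
     Rpower (h x) lam * Rpower (h y) (1 - lam) <= h (lam * x + (1 - lam) * y)) ->
  log_concave_on h a b.
Proof.
  intros H0 H; split; [exact H0|].
  intros x y lam Hx Hy Hl. apply Rle_ge.
  assert (Hz : 0 <= h (lam * x + (1 - lam) * y)) by (apply H0; nra).
  destruct (H0 x Hx) as [Px|Zx].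
  - destruct (H0 y Hy) as [Py|Zy].
    + rewrite !rpow_pos by assumption; auto.
    + rewrite <- Zy, rpow_0; lra.
  - rewrite <- Zx, rpow_0; lra.
Qed.

Lemma log_concave_elim (h : R -> R) (a b x y lam : R) :
  log_concave_on h a b -> a < x < b -> a < y < b -> 0 < lam < 1 ->
  0 < h x -> 0 < h y ->
  Rpower (h x) lam * Rpower (h y) (1 - lam) <= h (lam * x + (1 - lam) * y).
Proof.
  intros [_ H] Hx Hy Hl Px Py. specialize (H x y lam Hx Hy Hl).
  rewrite !rpow_pos in H by assumption; lra.
Qed.

Lemma log_concave_mult (g h : R -> R) (a b : R) :
  log_concave_on g a b -> log_concave_on h a b ->
  log_concave_on (fun x => g x * h x) a b.
Proof.
  intros Hg Hh. apply log_concave_intro.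
  - intros x Hx; apply Rmult_le_pos; [apply Hg|apply Hh]; exact Hx.
  - intros x y lam Hx Hy Hl Px Py.
    pose proof (proj1 Hg x Hx); pose proof (proj1 Hh x Hx).
    pose proof (proj1 Hg y Hy); pose proof (proj1 Hh y Hy).
    assert (0 < g x /\ 0 < h x /\ 0 < g y /\ 0 < h y) as (? & ? & ? & ?)
      by (repeat split; nra).
    rewrite <- !Rpower_mult_distr by assumption.
    pose proof (log_concave_elim g a b x y lam Hg Hx Hy Hl ltac:(auto) ltac:(auto)) as Eg.
    pose proof (log_concave_elim h a b x y lam Hh Hx Hy Hl ltac:(auto) ltac:(auto)) as Eh.
    pose proof (Rpower_gt_0 (g x) lam). pose proof (Rpower_gt_0 (h x) lam).
    pose proof (Rpower_gt_0 (g y) (1 - lam)). pose proof (Rpower_gt_0 (h y) (1 - lam)).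
    replace (Rpower (g x) lam * Rpower (h x) lam *
             (Rpower (g y) (1 - lam) * Rpower (h y) (1 - lam)))
      with (Rpower (g x) lam * Rpower (g y) (1 - lam) *
            (Rpower (h x) lam * Rpower (h y) (1 - lam))) by ring.
    apply Rmult_le_compat; try assumption; apply Rmult_le_pos; lra.
Qed.

Lemma log_concave_id (a b : R) : 0 <= a -> log_concave_on (fun x => x) a b.
Proof.
  intros Ha. apply log_concave_intro; [intros; lra|].
  intros; now apply weighted_AM_GM.
Qed.

Lemma log_concave_reflect (c a b : R) : b <= c -> log_concave_on (fun x => c - x) a b.
Proof.
  intros Hb. apply log_concave_intro; [intros; lra|].
  intros x y lam _ _ Hl Px Py.
  replace (c - (lam * x + (1 - lam) * y)) with (lam * (c - x) + (1 - lam) * (c - y)) by ring.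
  now apply weighted_AM_GM.
Qed.

Lemma log_concave_exp (t a b : R) : log_concave_on (fun x => exp (t * x)) a b.
Proof.
  apply log_concave_intro; [intros; left; apply exp_pos|].
  intros x y lam _ _ _ _ _. unfold Rpower. rewrite !ln_exp, <- exp_plus.
  right; f_equal; ring.
Qed.

(** The additive form of the inequality. Positivity at the intermediate point is recorded as well,
    because [ln] carries no information at nonpositive arguments. *)
Lemma log_concave_ln (h : R -> R) (a b x y lam : R) :
  log_concave_on h a b -> a < x < b -> a < y < b -> 0 < lam < 1 ->
  0 < h x -> 0 < h y ->
  0 < h (lam * x + (1 - lam) * y) /\
  lam * ln (h x) + (1 - lam) * ln (h y) <= ln (h (lam * x + (1 - lam) * y)).
Proof.
  intros Hh Hx Hy Hl Px Py.
  pose proof (log_concave_elim h a b x y lam Hh Hx Hy Hl Px Py) as E.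
  unfold Rpower in E; rewrite <- exp_plus in E.
  pose proof (exp_pos (lam * ln (h x) + (1 - lam) * ln (h y))).
  split; [lra|].
  rewrite <- (ln_exp (lam * ln (h x) + (1 - lam) * ln (h y))). apply ln_le; lra.
Qed.

(* If [m] lies between [s] and [d], log-concavity bounds [h s] by extrapolating from [d]
   through [m]. *)
Lemma log_concave_extrapolate (h : R -> R) (a b m d : R) :
  log_concave_on h a b -> a < m < b -> a < d < b -> 0 < h d ->
  exists K, 0 < K /\ forall s, a < s < b -> 0 < (s - m) * (m - d) -> h s <= K.
Proof.
  intros Hh Hm Hd Pd.
  set (Q := Rabs (ln (h m)) + Rabs (ln (h d))).
  exists (exp (Q * ((b - a) / Rabs (m - d)))). split; [apply exp_pos|].
  intros s Hs Hb.
  destruct (proj1 Hh s Hs) as [Ps|Zs].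
  2:{ rewrite <- Zs; left; apply exp_pos. }
  assert (Nd : m - d <> 0) by nra.
  assert (Ns : s - d <> 0) by nra.
  (* [m] is the convex combination of [s] and [d] with weight [/ r] on [s], so [ln (h s) <= r * ln
     (h m) - (r - 1) * ln (h d)]; and [r] is bounded because [s - d] is at most [b - a] in absolute
     value. *)
  set (r := (s - d) / (m - d)).
  assert (Hr1 : 1 < r).
  { unfold r. replace ((s - d) / (m - d)) with (1 + (s - m) * (m - d) / ((m - d) * (m - d)))
      by (field; lra).
    assert (0 < (s - m) * (m - d) / ((m - d) * (m - d))); [|lra].
    apply Rdiv_lt_0_compat; nra. }
  assert (Hr2 : r <= (b - a) / Rabs (m - d)).
  { rewrite <- (Rabs_pos_eq r) by lra. unfold r, Rdiv. rewrite Rabs_mult, Rabs_inv.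
    apply Rmult_le_compat_r; [left; apply Rinv_0_lt_compat; now apply Rabs_pos_lt|].
    apply Rabs_le; lra. }
  assert (Hl : 0 < / r < 1).
  { split; [apply Rinv_0_lt_compat; lra|].
    rewrite <- Rinv_1. apply Rinv_lt_contravar; lra. }
  destruct (log_concave_ln h a b s d (/ r) Hh Hs Hd Hl Ps Pd) as [Pm L].
  replace (/ r * s + (1 - / r) * d) with m in Pm, L by (unfold r; field; auto).
  rewrite <- (exp_ln (h s)) by exact Ps.
  apply Rnot_lt_le; intros C; apply exp_lt_inv in C.
  apply (Rmult_le_compat_l r) in L; [|lra].
  replace (r * (/ r * ln (h s) + (1 - / r) * ln (h d)))
    with (ln (h s) + (r - 1) * ln (h d)) in L by (field; lra).
  assert (ln (h m) <= Rabs (ln (h m))) by apply Rle_abs.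
  assert (- ln (h d) <= Rabs (ln (h d))) by (rewrite <- Rabs_Ropp; apply Rle_abs).
  assert (0 <= Rabs (ln (h d))) by apply Rabs_pos.
  assert (0 <= Rabs (ln (h m))) by apply Rabs_pos.
  assert (ln (h s) <= Q * r) by (unfold Q; nra).
  assert (Q * r <= Q * ((b - a) / Rabs (m - d))) by (apply Rmult_le_compat_l; [unfold Q|]; lra).
  lra.
Qed.

(** If [h] is positive at [c < d], extrapolation from [d] through the midpoint bounds [h] on the
    left of it, and extrapolation from [c] bounds [h] on the right. Otherwise [h] is positive at one
    point at most. *)
Lemma log_concave_bounded (h : R -> R) (a b : R) :
  log_concave_on h a b -> exists K, 0 < K /\ forall s, a < s < b -> h s <= K.
Proof.
  intros Hh.
  destruct (classic (exists c d, a < c < b /\ a < d < b /\ c < d /\ 0 < h c /\ 0 < h d))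
    as [(c & d & Hc & Hd & Hcd & Pc & Pd)|N].
  - set (m := (c + d) / 2).
    assert (Hm : a < m < b) by (unfold m; lra).
    destruct (log_concave_extrapolate h a b m c Hh Hm Hc Pc) as (K1 & P1 & B1).
    destruct (log_concave_extrapolate h a b m d Hh Hm Hd Pd) as (K2 & P2 & B2).
    pose proof (proj1 Hh m Hm).
    exists (K1 + K2 + h m); split; [lra|]. intros s Hs.
    destruct (Rtotal_order s m) as [L|[->|G]].
    + assert (h s <= K2) by (apply B2; [assumption|unfold m in *; nra]); lra.
    + lra.
    + assert (h s <= K1) by (apply B1; [assumption|unfold m in *; nra]); lra.
  - destruct (classic (exists c, a < c < b /\ 0 < h c)) as [(c & Hc & Pc)|N'].
    + exists (h c); split; [exact Pc|]. intros s Hs.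
      destruct (Rle_lt_dec (h s) 0) as [Q|Q]; [lra|].
      destruct (Rtotal_order s c) as [L|[->|G]]; [|lra|].
      * exfalso; apply N; exists s, c; auto.
      * exfalso; apply N; exists c, s; auto.
    + exists 1; split; [lra|]. intros s Hs.
      destruct (Rle_lt_dec (h s) 0) as [Q|Q]; [lra|].
      exfalso; apply N'; exists s; auto.
Qed.

(** Extension by zero, so that endpoints and unit translates leaving the interval are covered. *)
Definition cut (h : R -> R) (a b s : R) : R :=
  if Rlt_dec a s then if Rlt_dec s b then h s else 0 else 0.

Lemma cut_in (h : R -> R) (a b s : R) : a < s < b -> cut h a b s = h s.
Proof. intros Hs; unfold cut; destruct (Rlt_dec a s), (Rlt_dec s b); lra. Qed.

Lemma cut_out (h : R -> R) (a b s : R) : s <= a \/ b <= s -> cut h a b s = 0.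
Proof. intros Hs; unfold cut; destruct (Rlt_dec a s), (Rlt_dec s b); lra. Qed.

Lemma cut_pos_in (h : R -> R) (a b s : R) : 0 < cut h a b s -> a < s < b.
Proof. unfold cut; destruct (Rlt_dec a s), (Rlt_dec s b); lra. Qed.

Lemma cut_ge_0 (h : R -> R) (a b s : R) : log_concave_on h a b -> 0 <= cut h a b s.
Proof.
  intros Hh; unfold cut; destruct (Rlt_dec a s), (Rlt_dec s b); try lra.
  apply Hh; lra.
Qed.

(** The logarithm at [z] dominates a weighted mean of two logarithms exceeding [ln L]. The level
    [L = 0] is treated apart, where positivity at [z] is all that is asked. *)
Lemma cut_quasi_concave (h : R -> R) (a b L x y z : R) :
  log_concave_on h a b -> 0 <= L -> x <= z <= y ->
  L < cut h a b x -> L < cut h a b y -> L < cut h a b z.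
Proof.
  intros Hh HL Hz Lx Ly.
  pose proof (cut_pos_in h a b x ltac:(lra)) as Hx.
  pose proof (cut_pos_in h a b y ltac:(lra)) as Hy.
  destruct (Req_dec z x) as [->|Nx]; [exact Lx|].
  destruct (Req_dec z y) as [->|Ny]; [exact Ly|].
  rewrite cut_in in Lx, Ly |- * by lra.
  set (lam := (y - z) / (y - x)).
  assert (Hl : 0 < lam < 1).
  { unfold lam; split; [apply Rdiv_lt_0_compat; lra|].
    apply Rmult_lt_reg_r with (y - x); [lra|]. field_simplify; lra. }
  destruct (log_concave_ln h a b x y lam Hh Hx Hy Hl) as [Pz Q]; [lra|lra|].
  replace (lam * x + (1 - lam) * y) with z in Pz, Q by (unfold lam; field; lra).
  destruct HL as [HL| <-]; [|exact Pz].
  apply ln_lt_inv; [assumption..|].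
  apply ln_increasing in Lx; [|assumption].
  apply ln_increasing in Ly; [|assumption]. nra.
Qed.

(* The second-order total positivity of the translation kernel [cut h a b (y - z)]. *)
Lemma cut_shift_minor (h : R -> R) (a b y y' : R) :
  log_concave_on h a b -> y <= y' ->
  cut h a b y' * cut h a b (y - 1) <= cut h a b y * cut h a b (y' - 1).
Proof.
  intros Hh [Hy| <-]; [|lra].
  assert (P : 0 <= cut h a b y * cut h a b (y' - 1))
    by (apply Rmult_le_pos; now apply cut_ge_0).
  destruct (cut_ge_0 h a b y' Hh) as [P1|Z]; [|rewrite <- Z; lra].
  destruct (cut_ge_0 h a b (y - 1) Hh) as [P2|Z]; [|rewrite <- Z; lra].
  pose proof (cut_pos_in _ _ _ _ P1) as H1. pose proof (cut_pos_in _ _ _ _ P2) as H2.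
  rewrite cut_in in P1, P2 by assumption. rewrite !cut_in by lra.
  (* Both [y] and [y' - 1] lie between [y - 1] and [y'], with complementary weights; in the product
     of the two inequalities the exponents of each value add up to 1. *)
  set (lam := (y' - y) / (y' - y + 1)).
  assert (Hl : 0 < lam < 1).
  { unfold lam; split; [apply Rdiv_lt_0_compat; lra|].
    apply Rmult_lt_reg_r with (y' - y + 1); [lra|]. field_simplify; lra. }
  pose proof (log_concave_elim h a b y' (y - 1) (1 - lam) Hh H1 H2 ltac:(lra) P1 P2) as E1.
  pose proof (log_concave_elim h a b y' (y - 1) lam Hh H1 H2 Hl P1 P2) as E2.
  replace ((1 - lam) * y' + (1 - (1 - lam)) * (y - 1)) with y in E1 by (unfold lam; field; lra).
  replace (lam * y' + (1 - lam) * (y - 1)) with (y' - 1) in E2 by (unfold lam; field; lra).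
  replace (1 - (1 - lam)) with lam in E1 by ring.
  apply Rle_trans with
    (Rpower (h y') (1 - lam) * Rpower (h (y - 1)) lam *
     (Rpower (h y') lam * Rpower (h (y - 1)) (1 - lam))).
  - right. unfold Rpower. rewrite <- !exp_plus.
    rewrite <- (exp_ln (h y')) at 1 by assumption.
    rewrite <- (exp_ln (h (y - 1))) at 1 by assumption.
    rewrite <- exp_plus. f_equal; ring.
  - apply Rmult_le_compat; try assumption; apply Rmult_le_pos; left; apply Rpower_gt_0.
Qed.

(** * Riemann integrability *)

Definition indic (Q : R -> Prop) (x : R) : R :=
  if excluded_middle_informative (Q x) then 1 else 0.

Lemma indic_true (Q : R -> Prop) (x : R) : Q x -> indic Q x = 1.
Proof. unfold indic; destruct (excluded_middle_informative (Q x)); tauto. Qed.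

Lemma indic_false (Q : R -> Prop) (x : R) : ~ Q x -> indic Q x = 0.
Proof. unfold indic; destruct (excluded_middle_informative (Q x)); tauto. Qed.

(** Within [[a, b]] the set [Q] is an interval from [p] to [r], up to its endpoints: the integrand
    is [k] between them and zero outside. *)
Lemma ex_RInt_indic_convex (k : R -> R) (Q : R -> Prop) (a b : R) :
  a <= b -> (forall x, continuous k x) ->
  (forall x y z, x <= z <= y -> Q x -> Q y -> Q z) ->
  ex_RInt (fun x => k x * indic Q x) a b.
Proof.
  intros Hab Ck HQ.
  assert (Z : forall c d, c <= d -> (forall x, c < x < d -> ~ Q x) ->
    ex_RInt (fun x => k x * indic Q x) c d).
  { intros c d Hcd HN. apply ex_RInt_ext with (fun _ => 0).
    - intros x Hx. rewrite Rmin_left, Rmax_right in Hx by lra.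
      rewrite indic_false by (apply HN; lra). symmetry; apply Rmult_0_r.
    - apply ex_RInt_const. }
  destruct (classic (exists x, a <= x <= b /\ Q x)) as [(x0 & Hx0 & Q0)|N].
  2:{ apply Z; [assumption|]. intros x Hx Qx; apply N; exists x; split; [lra|assumption]. }
  destruct (completeness (fun x => a <= x <= b /\ Q x)) as [r [Ur Lr]].
  { exists b; intros x [Hx _]; lra. }
  { exists x0; auto. }
  (* The infimum [p] is obtained as minus the supremum of the reflected set. *)
  destruct (completeness (fun x => a <= - x <= b /\ Q (- x))) as [p' [Up Lp]].
  { exists (- a); intros x [Hx _]; lra. }
  { exists (- x0); rewrite Ropp_involutive; auto. }
  set (p := - p').
  assert (Up' : forall x, a <= x <= b -> Q x -> p <= x).
  { intros x Hx Qx. assert (- x <= p') by (apply Up; rewrite Ropp_involutive; auto).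
    unfold p; lra. }
  assert (Hpx : p <= x0) by auto.
  assert (Hrx : x0 <= r) by (apply Ur; auto).
  assert (Hrb : r <= b) by (apply Lr; intros x [Hx _]; lra).
  assert (Hpa : a <= p).
  { assert (p' <= - a) by (apply Lp; intros x [Hx _]; lra). unfold p; lra. }
  apply ex_RInt_Chasles with p; [|apply ex_RInt_Chasles with r].
  - apply Z; [assumption|]. intros x Hx Qx. pose proof (Up' x ltac:(lra) Qx); lra.
  - apply ex_RInt_ext with k.
    + intros x Hx. rewrite Rmin_left, Rmax_right in Hx by lra.
      rewrite indic_true; [symmetry; apply Rmult_1_r|].
      assert (exists u, u <= x /\ Q u) as (u & Hu & Qu).
      { apply NNPP; intros N. assert (p' <= - x); [|unfold p in Hx; lra].
        apply Lp. intros v [Hv Qv]. apply Rnot_lt_le; intros C.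
        apply N; exists (- v); split; [lra|assumption]. }
      assert (exists v, x <= v /\ Q v) as (v & Hv & Qv).
      { apply NNPP; intros N. assert (r <= x); [|lra].
        apply Lr. intros v [Hv Qv]. apply Rnot_lt_le; intros C.
        apply N; exists v; split; [lra|assumption]. }
      apply HQ with u v; auto.
    + apply (ex_RInt_continuous (V := R_CompleteNormedModule)); auto.
  - apply Z; [assumption|]. intros x Hx Qx.
    assert (x <= r) by (apply Ur; split; [lra|assumption]); lra.
Qed.

(** Layer-cake staircase below [g]: [d] times the number of levels among [d], [2 d], ..., [n d] that
    are strictly below [g x]. *)
Fixpoint layers (g : R -> R) (d : R) (n : nat) (x : R) : R :=
  match n with
  | O => 0
  | S m => layers g d m x + d * indic (fun y => INR n * d < g y) x
  end.

(** The first clause, where all levels are passed, carries the induction through the step in which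
    [g x] falls between the last two levels. *)
Lemma layers_approx (g : R -> R) (d : R) (n : nat) (x : R) : 0 <= d -> 0 <= g x ->
  (INR n * d < g x -> layers g d n x = INR n * d) /\
  (g x <= INR n * d -> g x - d <= layers g d n x <= g x).
Proof.
  intros Hd Hg. induction n as [|n [IH1 IH2]].
  - simpl; split; intros; lra.
  - change (layers g d (S n) x)
      with (layers g d n x + d * indic (fun y => INR (S n) * d < g y) x).
    rewrite S_INR in *. split; intros H.
    + rewrite indic_true by exact H. rewrite IH1 by lra. ring.
    + rewrite indic_false by lra.
      destruct (Rlt_le_dec (INR n * d) (g x)) as [L|L].
      * rewrite IH1 by exact L. lra.
      * specialize (IH2 L); lra.
Qed.

Lemma ex_RInt_layers (k g : R -> R) (a b d : R) (n : nat) :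
  a <= b -> (forall x, continuous k x) -> 0 <= d ->
  (forall L x y z, 0 <= L -> x <= z <= y -> L < g x -> L < g y -> L < g z) ->
  ex_RInt (fun x => k x * layers g d n x) a b.
Proof.
  intros Hab Ck Hd Hg. induction n as [|n IH].
  - apply ex_RInt_ext with (fun _ => 0); [|apply ex_RInt_const].
    intros x _; simpl; symmetry; apply Rmult_0_r.
  - apply ex_RInt_ext with (fun x => plus (k x * layers g d n x)
      (scal d (k x * indic (fun y => INR (S n) * d < g y) x))).
    { intros x _. unfold plus, scal; simpl; unfold mult; simpl. ring. }
    apply (ex_RInt_plus (V := R_NormedModule)); [exact IH|].
    apply (ex_RInt_scal (V := R_NormedModule)). apply ex_RInt_indic_convex; auto.
    intros x y z Hz Hx Hy. apply Hg with x y; auto.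
    apply Rmult_le_pos; [apply pos_INR|assumption].
Qed.

Lemma uniform_limit_ex_RInt (f : R -> R) (a b : R) :
  a <= b ->
  (forall eps, 0 < eps -> exists g, ex_RInt g a b /\
     forall x, a <= x <= b -> Rabs (f x - g x) <= eps) ->
  ex_RInt f a b.
Proof.
  intros Hab H.
  assert (E : forall n : nat, exists g, ex_RInt g a b /\
    forall x, a <= x <= b -> Rabs (f x - g x) <= / (INR n + 1)).
  { intros n; apply H. apply Rinv_0_lt_compat. pose proof (pos_INR n); lra. }
  apply choice in E. destruct E as [g Hg].
  (* [filterlim_RInt] asks for uniform convergence on the whole line, so every function is set to
     zero outside [[a, b]]. *)
  set (c := fun (u : R -> R) x => if Rle_dec a x then if Rle_dec x b then u x else 0 else 0).
  assert (Hc : forall u x, a <= x <= b -> c u x = u x).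
  { intros u x Hx; unfold c; destruct (Rle_dec a x), (Rle_dec x b); lra. }
  destruct (filterlim_RInt (V := R_CompleteNormedModule) (fun n => c (g n)) a b eventually _
              (c f) (fun n => RInt (c (g n)) a b)) as (l & _ & Hl).
  - intros n. apply (RInt_correct (V := R_CompleteNormedModule)).
    apply ex_RInt_ext with (g n); [|apply Hg].
    intros x Hx. rewrite Rmin_left, Rmax_right in Hx by lra. rewrite Hc; lra.
  - apply (filterlim_locally (U := fct_UniformSpace R R_CompleteNormedModule)). intros eps.
    destruct (archimed_cor1 eps (cond_pos eps)) as (N & HN & HN0).
    exists N. intros n Hn x. change (Rabs (c (g n) x - c f x) < eps).
    assert (B : Rabs (c (g n) x - c f x) <= / (INR n + 1)).
    { rewrite Rabs_minus_sym. unfold c at 1 2.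
      pose proof (pos_INR n).
      assert (0 < / (INR n + 1)) by (apply Rinv_0_lt_compat; lra).
      destruct (Rle_dec a x), (Rle_dec x b); try (rewrite Rminus_diag, Rabs_R0; lra).
      apply Hg; lra. }
    apply Rle_lt_trans with (1 := B). apply Rle_lt_trans with (2 := HN).
    apply Rinv_le_contravar; [now apply lt_0_INR|].
    apply le_INR in Hn. lra.
  - exists l. apply is_RInt_ext with (2 := Hl).
    intros x Hx. rewrite Rmin_left, Rmax_right in Hx by lra. apply Hc; lra.
Qed.

(* A quasi-concave function is a uniform limit of sums of indicators of its superlevel
   sets, which are intervals. *)
Lemma ex_RInt_quasi_concave (k g : R -> R) (K a b : R) :
  a <= b -> (forall x, continuous k x) -> (forall x, 0 <= g x <= K) ->
  (forall L x y z, 0 <= L -> x <= z <= y -> L < g x -> L < g y -> L < g z) ->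
  ex_RInt (fun x => k x * g x) a b.
Proof.
  intros Hab Ck Bg Hg. apply uniform_limit_ex_RInt; [assumption|]. intros eps Heps.
  destruct (continuity_ab_maj (fun x => Rabs (k x)) a b Hab) as (xm & Hxm & _).
  { intros c _. apply continuity_pt_filterlim.
    apply (continuous_comp k Rabs); [apply Ck|apply continuous_Rabs]. }
  set (J := Rabs (k xm) + 1).
  assert (HJ : 0 < J) by (unfold J; pose proof (Rabs_pos (k xm)); lra).
  set (d := eps / J).
  assert (Hd : 0 < d) by (apply Rdiv_lt_0_compat; lra).
  (* With [n * d] above the bound [K], no value of [g] passes the top layer, and the staircase is
     within [d = eps / J] of [g]. *)
  destruct (INR_unbounded (K / d)) as [n Hn].
  exists (fun x => k x * layers g d n x). split.
  { apply ex_RInt_layers; auto; lra. }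
  intros x Hx. rewrite <- Rmult_minus_distr_l, Rabs_mult.
  replace eps with (J * d) by (unfold d; field; lra).
  apply Rmult_le_compat; try apply Rabs_pos.
  - unfold J. specialize (Hxm x Hx); lra.
  - destruct (layers_approx g d n x) as [_ A]; [lra|apply Bg|].
    assert (g x <= INR n * d).
    { apply Rle_trans with K; [apply Bg|]. left.
      apply Rmult_lt_reg_r with (/ d); [now apply Rinv_0_lt_compat|].
      rewrite Rmult_assoc, Rinv_r, Rmult_1_r by lra. exact Hn. }
    specialize (A H). rewrite Rabs_pos_eq; lra.
Qed.

(** A log-concave function may jump at the ends of its support, so integrability rests on
    boundedness and quasi-concavity instead of continuity. *)
Lemma ex_RInt_log_concave (k h : R -> R) (M a b : R) :
  a <= b -> (forall x, continuous k x) -> log_concave_on h 0 M ->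
  ex_RInt (fun x => k x * cut h 0 M x) a b.
Proof.
  intros Hab Ck Hh. destruct (log_concave_bounded h 0 M Hh) as (K & HK & BK).
  apply ex_RInt_quasi_concave with K; auto.
  - intros x; split; [now apply cut_ge_0|].
    unfold cut; destruct (Rlt_dec 0 x), (Rlt_dec x M); try lra. apply BK; lra.
  - intros L x y z HL Hz. now apply cut_quasi_concave.
Qed.

Lemma Rint_RInt (g : R -> R) (a b : R) : ex_RInt g a b -> Rint g a b = RInt g a b.
Proof.
  intros Hg. unfold Rint.
  destruct (excluded_middle_informative _) as [H|N].
  - destruct (constructive_indefinite_description _ H) as [v [pr E]]. simpl.
    rewrite <- E. symmetry; apply RInt_Reals.
  - exfalso; apply N. exists (RiemannInt (ex_RInt_Reals_0 g a b Hg)).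
    now exists (ex_RInt_Reals_0 g a b Hg).
Qed.

(** * The generalized binomial coefficient *)

(* Unlike [rpow], this is continuous on the whole line for [y > 0], because [Rpower x y = 1]
   for [x <= 0]. *)
Definition ppow (x y : R) : R := if Rlt_dec 0 x then Rpower x y else 0.

Lemma ppow_pos (x y : R) : 0 < x -> ppow x y = Rpower x y.
Proof. intros Hx; unfold ppow; destruct (Rlt_dec 0 x); lra. Qed.

Lemma ppow_neg (x y : R) : x <= 0 -> ppow x y = 0.
Proof. intros Hx; unfold ppow; destruct (Rlt_dec 0 x); lra. Qed.

Lemma ppow_small (y eps : R) : 0 < y -> 0 < eps ->
  exists del : posreal, forall x, Rabs x < del -> Rabs (ppow x y) < eps.
Proof.
  (* The radius is the [y]-th root of [eps]. *)
  intros Hy He. exists (mkposreal (Rpower eps (/ y)) (Rpower_gt_0 _ _)). simpl.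
  intros x Hx. destruct (Rlt_dec 0 x) as [P|N].
  - rewrite ppow_pos by assumption. rewrite Rabs_pos_eq in Hx by lra.
    rewrite Rabs_pos_eq by (left; apply Rpower_gt_0).
    replace eps with (Rpower (Rpower eps (/ y)) y).
    + apply Rlt_Rpower_l; lra.
    + rewrite Rpower_mult, Rinv_l, Rpower_1; lra.
  - rewrite ppow_neg, Rabs_R0 by lra; lra.
Qed.

Lemma locally_pos (x : R) : 0 < x -> locally x (fun u => 0 < u).
Proof. intros Hx. apply (open_gt 0 x Hx). Qed.

Lemma locally_neg (x : R) : x < 0 -> locally x (fun u => u < 0).
Proof. intros Hx. apply (open_lt 0 x Hx). Qed.

(** The delicate point is 0, where the difference quotient equals [ppow h (y - 1)] and tends to 0
    because [y > 1]. *)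
Lemma is_derive_ppow (x y : R) : 1 < y -> is_derive (fun u => ppow u y) x (y * ppow x (y - 1)).
Proof.
  intros Hy. destruct (Rtotal_order x 0) as [N|[->|P]].
  - rewrite ppow_neg, Rmult_0_r by lra.
    apply is_derive_ext_loc with (fun _ => 0).
    + apply filter_imp with (2 := locally_neg x N). intros u Hu. now rewrite ppow_neg by lra.
    + apply (is_derive_const (K := R_AbsRing) (V := R_NormedModule)).
  - rewrite (ppow_neg 0), Rmult_0_r by lra. apply is_derive_Reals. intros eps He.
    destruct (ppow_small (y - 1) eps ltac:(lra) He) as [del Hdel].
    exists del. intros h Hh Hd. rewrite Rplus_0_l, (ppow_neg 0), !Rminus_0_r by lra.
    replace (ppow h y / h) with (ppow h (y - 1)); [now apply Hdel|].
    destruct (Rlt_dec 0 h) as [P|N].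
    + rewrite !ppow_pos by assumption. unfold Rdiv. replace (/ h) with (Rpower h (Ropp 1)).
      * rewrite <- Rpower_plus. f_equal; ring.
      * rewrite Rpower_Ropp, Rpower_1; [reflexivity|assumption].
    + rewrite !ppow_neg by lra. now field.
  - apply is_derive_ext_loc with (fun u => Rpower u y).
    + apply filter_imp with (2 := locally_pos x P). intros u Hu. now rewrite ppow_pos.
    + rewrite ppow_pos by assumption. apply is_derive_Reals.
      now apply derivable_pt_lim_power.
Qed.

Lemma continuous_ppow (x y : R) : 0 < y -> continuous (fun u => ppow u y) x.
Proof.
  intros Hy. destruct (Rtotal_order x 0) as [N|[->|P]].
  - apply continuous_ext_loc with (fun _ => 0).
    + apply filter_imp with (2 := locally_neg x N). intros u Hu. now rewrite ppow_neg by lra.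
    + apply continuous_const.
  - apply filterlim_locally. intros eps.
    destruct (ppow_small y eps Hy (cond_pos eps)) as [del Hdel].
    exists del. intros u Hu. change (Rabs (ppow u y - ppow 0 y) < eps).
    change (Rabs (u - 0) < del) in Hu.
    rewrite (ppow_neg 0), Rminus_0_r by lra. rewrite Rminus_0_r in Hu. auto.
  - apply continuous_ext_loc with (fun u => Rpower u y).
    + apply filter_imp with (2 := locally_pos x P). intros u Hu. now rewrite ppow_pos.
    + apply (ex_derive_continuous (K := R_AbsRing) (V := R_NormedModule)).
      exists (y * Rpower x (y - 1)). apply is_derive_Reals. now apply derivable_pt_lim_power.
Qed.

(** Exponents are one less than the Beta parameters: for positive [a] and [b] this integrates to
    [Beta (a + 1) (b + 1)], and [ppow] makes it continuous at 0 and 1. *)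
Definition beta_density (a b t : R) : R := ppow t a * ppow (1 - t) b.

Lemma beta_density_continuous (a b t : R) : 0 < a -> 0 < b -> continuous (beta_density a b) t.
Proof.
  intros Ha Hb. apply (continuous_mult (fun t => ppow t a) (fun t => ppow (1 - t) b)).
  - now apply continuous_ppow.
  - apply (continuous_comp (fun t => 1 - t) (fun u => ppow u b)).
    + apply (ex_derive_continuous (K := R_AbsRing) (V := R_NormedModule)). auto_derive; auto.
    + now apply continuous_ppow.
Qed.

Lemma beta_density_pos (a b t : R) : 0 < t < 1 -> 0 < beta_density a b t.
Proof.
  intros Ht. unfold beta_density. rewrite !ppow_pos by lra.
  apply Rmult_lt_0_compat; apply Rpower_gt_0.
Qed.

Lemma ex_RInt_beta_density (a b : R) : 0 < a -> 0 < b -> ex_RInt (beta_density a b) 0 1.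
Proof.
  intros Ha Hb. apply (ex_RInt_continuous (V := R_CompleteNormedModule)).
  intros t _; now apply beta_density_continuous.
Qed.

Lemma Beta_RInt (a b : R) : 0 < a -> 0 < b ->
  Beta (a + 1) (b + 1) = RInt (beta_density a b) 0 1.
Proof.
  intros Ha Hb.
  assert (E : forall t, Rmin 0 1 < t < Rmax 0 1 ->
    beta_density a b t = rpow t (a + 1 - 1) * rpow (1 - t) (b + 1 - 1)).
  { intros t Ht. rewrite Rmin_left, Rmax_right in Ht by lra.
    unfold beta_density. rewrite !ppow_pos, !rpow_pos by lra.
    now replace (a + 1 - 1) with a by ring; replace (b + 1 - 1) with b by ring. }
  unfold Beta. rewrite Rint_RInt.
  - symmetry. now apply RInt_ext.
  - apply ex_RInt_ext with (1 := E). now apply ex_RInt_beta_density.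
Qed.

Lemma Beta_pos (a b : R) : 0 < a -> 0 < b -> 0 < Beta (a + 1) (b + 1).
Proof.
  intros Ha Hb. rewrite Beta_RInt by assumption. apply RInt_gt_0; [lra| |].
  - intros; now apply beta_density_pos.
  - intros; now apply beta_density_continuous.
Qed.

(** Integration by parts: the function [t^(a+1) (1-t)^b] vanishes at both ends of [[0, 1]], and its
    derivative is the difference of the two integrands. *)
Lemma Beta_shift (a b : R) : 0 < a -> 1 < b ->
  (a + 1) * Beta (a + 1) (b + 1) = b * Beta (a + 1 + 1) (b - 1 + 1).
Proof.
  intros Ha Hb. rewrite !Beta_RInt by lra.
  pose proof (RInt_correct _ _ _ (ex_RInt_beta_density a b Ha ltac:(lra))) as I1.
  pose proof (RInt_correct _ _ _ (ex_RInt_beta_density (a + 1) (b - 1) ltac:(lra) ltac:(lra))) as I2.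
  pose proof (is_RInt_minus _ _ _ _ _ _ (is_RInt_scal _ _ _ (a + 1) _ I1)
    (is_RInt_scal _ _ _ b _ I2)) as I.
  assert (J : is_RInt (fun t => minus (scal (a + 1) (beta_density a b t))
      (scal b (beta_density (a + 1) (b - 1) t))) 0 1
      (minus (beta_density (a + 1) b 1) (beta_density (a + 1) b 0))).
  { apply (is_RInt_derive (V := R_CompleteNormedModule)).
    - intros t _.
      assert (D1 : is_derive (fun u => ppow u (a + 1)) t ((a + 1) * ppow t a)).
      { replace (ppow t a) with (ppow t (a + 1 - 1)) by (f_equal; ring). apply is_derive_ppow; lra. }
      assert (D2 : is_derive (fun u => ppow (1 - u) b) t (- 1 * (b * ppow (1 - t) (b - 1)))).
      { apply (is_derive_comp (fun v => ppow v b) (fun u => 1 - u)).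
        - now apply is_derive_ppow.
        - auto_derive; [auto|ring]. }
      pose proof (is_derive_mult _ _ t _ _ D1 D2 Rmult_comm) as D.
      refine (eq_rect _ (is_derive _ t) D _ _).
      unfold beta_density, minus, plus, opp, scal, mult; simpl; unfold mult, plus; simpl; ring.
    - intros t _. apply (continuous_minus (V := R_NormedModule)).
      + apply (continuous_scal_r (V := R_NormedModule)); apply beta_density_continuous; lra.
      + apply (continuous_scal_r (V := R_NormedModule)); apply beta_density_continuous; lra. }
  pose proof (eq_trans (eq_sym (is_RInt_unique (V := R_CompleteNormedModule) _ _ _ _ I))
    (is_RInt_unique (V := R_CompleteNormedModule) _ _ _ _ J)) as E.
  unfold beta_density at 3 4 in E. rewrite (ppow_neg 0 (a + 1)) in E by lra.
  rewrite (ppow_neg (1 - 1)) in E by lra.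
  unfold minus, plus, opp, scal in E; simpl in E. unfold mult in E; simpl in E. lra.
Qed.

(* Hoelder's inequality for the Beta integral. *)
Lemma Beta_log_convex (M x y lam : R) :
  0 < x < M -> 0 < y < M -> 0 < lam < 1 ->
  Beta (lam * x + (1 - lam) * y + 1) (M - (lam * x + (1 - lam) * y) + 1) <=
  Rpower (Beta (x + 1) (M - x + 1)) lam * Rpower (Beta (y + 1) (M - y + 1)) (1 - lam).
Proof.
  intros Hx Hy Hl. set (z := lam * x + (1 - lam) * y).
  assert (Hz : 0 < z < M) by (unfold z; nra).
  set (U := Beta (x + 1) (M - x + 1)). set (V := Beta (y + 1) (M - y + 1)).
  assert (PU : 0 < U) by (apply Beta_pos; lra).
  assert (PV : 0 < V) by (apply Beta_pos; lra).
  set (W := Rpower U lam * Rpower V (1 - lam)).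
  assert (PW : 0 < W) by (apply Rmult_lt_0_compat; apply Rpower_gt_0).
  pose proof (RInt_correct _ _ _ (ex_RInt_beta_density x (M - x) ltac:(lra) ltac:(lra))) as I1.
  pose proof (RInt_correct _ _ _ (ex_RInt_beta_density y (M - y) ltac:(lra) ltac:(lra))) as I2.
  rewrite <- Beta_RInt in I1, I2 by lra. fold U in I1. fold V in I2.
  (* Weighted AM-GM for the two normalised densities, scaled by [W], gives this majorant; its
     integral is [W * lam + W * (1 - lam) = W]. *)
  assert (I : is_RInt (fun t => W * lam / U * beta_density x (M - x) t +
      W * (1 - lam) / V * beta_density y (M - y) t) 0 1 W).
  { refine (eq_rect _ (is_RInt _ 0 1) (is_RInt_plus _ _ _ _ _ _
      (is_RInt_scal _ _ _ (W * lam / U) _ I1) (is_RInt_scal _ _ _ (W * (1 - lam) / V) _ I2)) _ _).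
    unfold plus, scal; simpl; unfold mult; simpl. field; lra. }
  rewrite Beta_RInt by lra.
  replace W with (RInt (fun t => W * lam / U * beta_density x (M - x) t +
      W * (1 - lam) / V * beta_density y (M - y) t) 0 1)
    by exact (is_RInt_unique (V := R_CompleteNormedModule) _ _ _ _ I).
  apply RInt_le; [lra|apply ex_RInt_beta_density; lra|eexists; exact I|].
  intros t Ht.
  pose proof (beta_density_pos x (M - x) t Ht) as Px.
  pose proof (beta_density_pos y (M - y) t Ht) as Py.
  pose proof (weighted_AM_GM (beta_density x (M - x) t / U) (beta_density y (M - y) t / V) lam
    ltac:(now apply Rdiv_lt_0_compat) ltac:(now apply Rdiv_lt_0_compat) Hl) as Y.
  apply (Rmult_le_compat_l W) in Y; [|lra].
  replace (W * lam / U * beta_density x (M - x) t + W * (1 - lam) / V * beta_density y (M - y) t)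
    with (W * (lam * (beta_density x (M - x) t / U) + (1 - lam) * (beta_density y (M - y) t / V)))
    by (field; lra).
  apply Rle_trans with (2 := Y). right.
  unfold Rdiv. rewrite <- !Rpower_mult_distr by (try apply Rinv_0_lt_compat; lra).
  unfold W, beta_density. rewrite !ppow_pos by lra.
  rewrite <- !Rpower_mult_distr by apply Rpower_gt_0.
  unfold Rpower. rewrite !ln_exp, !ln_Rinv by assumption. rewrite <- !exp_plus.
  f_equal. unfold z; ring.
Qed.

Lemma binomR_pos (M s : R) : 0 < s < M -> 0 < binomR M s.
Proof.
  intros Hs. unfold binomR. apply Rinv_0_lt_compat. apply Rmult_lt_0_compat; [lra|].
  apply Beta_pos; lra.
Qed.

(** [Beta_shift] at [a = s], [b = M - s], after taking reciprocals; [s < M - 1] is its condition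
    [1 < b]. *)
Lemma binomR_shift (M s : R) : 0 < s < M - 1 ->
  (s + 1) * binomR M (s + 1) = (M - s) * binomR M s.
Proof.
  intros Hs. unfold binomR.
  pose proof (Beta_shift s (M - s) ltac:(lra) ltac:(lra)) as E.
  replace (M - (s + 1) + 1) with (M - s - 1 + 1) by ring.
  pose proof (Beta_pos s (M - s) ltac:(lra) ltac:(lra)).
  pose proof (Beta_pos (s + 1) (M - s - 1) ltac:(lra) ltac:(lra)).
  apply Rmult_eq_reg_r with
    ((M + 1) * Beta (s + 1 + 1) (M - s - 1 + 1) * Beta (s + 1) (M - s + 1)).
  - field_simplify; [lra| |]; repeat split; lra.
  - apply Rgt_not_eq. apply Rmult_lt_0_compat; [apply Rmult_lt_0_compat|]; lra.
Qed.

(** The reciprocal of a log-convex function is log-concave; the constant [M + 1] factors out because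
    the weights add up to 1. *)
Lemma binomR_log_concave (M : R) : log_concave_on (binomR M) 0 M.
Proof.
  apply log_concave_intro.
  - intros x Hx; left; now apply binomR_pos.
  - intros x y lam Hx Hy Hl _ _.
    pose proof (Beta_log_convex M x y lam Hx Hy Hl) as H.
    set (z := lam * x + (1 - lam) * y) in *.
    assert (Hz : 0 < z < M) by (unfold z; nra).
    pose proof (Beta_pos x (M - x) ltac:(lra) ltac:(lra)) as PU.
    pose proof (Beta_pos y (M - y) ltac:(lra) ltac:(lra)) as PV.
    pose proof (Beta_pos z (M - z) ltac:(lra) ltac:(lra)) as PZ.
    unfold binomR.
    set (U := Beta (x + 1) (M - x + 1)) in *. set (V := Beta (y + 1) (M - y + 1)) in *.
    apply Rle_trans with (/ ((M + 1) * (Rpower U lam * Rpower V (1 - lam)))).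
    + right. unfold Rpower.
      rewrite !ln_Rinv, !ln_mult by (try apply Rmult_lt_0_compat; lra).
      replace (M + 1) with (exp (ln (M + 1))) at 3 by (apply exp_ln; lra).
      rewrite <- !exp_plus, <- exp_Ropp. f_equal; ring.
    + apply Rinv_le_contravar.
      * apply Rmult_lt_0_compat; lra.
      * apply Rmult_le_compat_l; lra.
Qed.

(** * Exponential moments of a log-concave density *)

(** Four terms, as in the expansion of a product of two 2 by 2 minors. *)
Lemma is_RInt_lin4 (f1 f2 f3 f4 : R -> R) (a b c1 c2 c3 c4 I1 I2 I3 I4 : R) :
  is_RInt f1 a b I1 -> is_RInt f2 a b I2 -> is_RInt f3 a b I3 -> is_RInt f4 a b I4 ->
  is_RInt (fun y => c1 * f1 y + c2 * f2 y + c3 * f3 y + c4 * f4 y) a b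
    (c1 * I1 + c2 * I2 + c3 * I3 + c4 * I4).
Proof.
  intros H1 H2 H3 H4.
  apply (is_RInt_plus (V := R_NormedModule)); [apply (is_RInt_plus (V := R_NormedModule));
    [apply (is_RInt_plus (V := R_NormedModule))|]|];
    apply (is_RInt_scal (V := R_NormedModule)); assumption.
Qed.

Lemma is_RInt_ge_0 (f : R -> R) (a b I : R) :
  a <= b -> is_RInt f a b I -> (forall y, a < y < b -> 0 <= f y) -> 0 <= I.
Proof.
  intros Hab HI Hf.
  rewrite <- (is_RInt_unique (V := R_CompleteNormedModule) _ _ _ _ HI).
  apply RInt_ge_0; auto. eexists; exact HI.
Qed.

Lemma lin4_ge_0 (f1 f2 f3 f4 : R -> R) (a b c1 c2 c3 c4 I1 I2 I3 I4 : R) :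
  a <= b ->
  is_RInt f1 a b I1 -> is_RInt f2 a b I2 -> is_RInt f3 a b I3 -> is_RInt f4 a b I4 ->
  (forall y, a < y < b -> 0 <= c1 * f1 y + c2 * f2 y + c3 * f3 y + c4 * f4 y) ->
  0 <= c1 * I1 + c2 * I2 + c3 * I3 + c4 * I4.
Proof.
  intros Hab H1 H2 H3 H4. apply is_RInt_ge_0 with (1 := Hab). now apply is_RInt_lin4.
Qed.

(* Integrating the hypothesis first in [y] and then in [y'] needs no Fubini theorem, since
   it is a sum of products. *)
Lemma iterated_RInt_ge_0 (f1 f2 f3 f4 : R -> R) (a b I1 I2 I3 I4 : R) :
  a <= b ->
  is_RInt f1 a b I1 -> is_RInt f2 a b I2 -> is_RInt f3 a b I3 -> is_RInt f4 a b I4 ->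
  (forall y y', 0 <= f1 y * f4 y' - f2 y * f3 y' - f3 y * f2 y' + f4 y * f1 y') ->
  I2 * I3 <= I1 * I4.
Proof.
  intros Hab H1 H2 H3 H4 H.
  (* The hypothesis is symmetric in [y] and [y'], so its double integral is twice
     [I1 * I4 - I2 * I3]. *)
  enough (0 <= I4 * I1 + - I3 * I2 + - I2 * I3 + I1 * I4) by lra.
  apply (lin4_ge_0 f1 f2 f3 f4 a b); auto. intros y' _.
  enough (0 <= f4 y' * I1 + - f3 y' * I2 + - f2 y' * I3 + f1 y' * I4) by lra.
  apply (lin4_ge_0 f1 f2 f3 f4 a b); auto. intros y _.
  specialize (H y y'); lra.
Qed.

(** Serves to bring integrals of functions extended by zero, and of their translates, to a common
    interval. *)
Lemma is_RInt_zero_ends (g : R -> R) (a c d b l : R) :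
  a <= c <= d -> d <= b ->
  (forall x, a < x < c -> g x = 0) -> (forall x, d < x < b -> g x = 0) ->
  is_RInt g c d l -> is_RInt g a b l.
Proof.
  intros Hac Hdb Z1 Z2 H.
  assert (Z : forall u v, u <= v -> (forall x, u < x < v -> g x = 0) -> is_RInt g u v 0).
  { intros u v Huv Hg. apply is_RInt_ext with (fun _ => 0).
    - intros x Hx. rewrite Rmin_left, Rmax_right in Hx by lra. now rewrite Hg.
    - refine (eq_rect _ (is_RInt _ u v) (is_RInt_const (V := R_NormedModule) u v 0) _ _).
      apply Rmult_0_r. }
  replace l with (plus 0 (plus l 0)) by (unfold plus; simpl; ring).
  apply (is_RInt_Chasles (V := R_NormedModule)) with c; [apply Z; auto; lra|].
  apply (is_RInt_Chasles (V := R_NormedModule)) with d; [exact H|apply Z; auto].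
Qed.

Lemma is_RInt_shift1 (g : R -> R) (a b l : R) :
  is_RInt g a b l -> is_RInt (fun y => g (y - 1)) (a + 1) (b + 1) l.
Proof.
  intros H. apply is_RInt_ext with (fun y => scal 1 (g (1 * y + - 1))).
  - intros x _. unfold scal; simpl; unfold mult; simpl. rewrite Rmult_1_l. f_equal; ring.
  - apply (is_RInt_comp_lin (V := R_NormedModule)).
    replace (1 * (a + 1) + -1) with a by ring. now replace (1 * (b + 1) + -1) with b by ring.
Qed.

Lemma is_RInt_scalR (g : R -> R) (a b c l : R) :
  is_RInt g a b l -> is_RInt (fun y => c * g y) a b (c * l).
Proof. apply (is_RInt_scal (V := R_NormedModule)). Qed.

(** Unnormalised [j]-th moment of the density [h] under the exponential tilt of parameter [t]. *)
Definition moment (h : R -> R) (M : R) (j : nat) (t : R) : R :=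
  RInt (fun s => s ^ j * exp (t * s) * cut h 0 M s) 0 M.

Lemma is_RInt_moment (h : R -> R) (M : R) (j : nat) (t : R) :
  0 < M -> log_concave_on h 0 M ->
  is_RInt (fun s => s ^ j * exp (t * s) * cut h 0 M s) 0 M (moment h M j t).
Proof.
  intros HM Hh. apply (RInt_correct (V := R_CompleteNormedModule)).
  apply ex_RInt_log_concave; [lra| |assumption]. intros x.
  apply (ex_derive_continuous (K := R_AbsRing) (V := R_NormedModule)). auto_derive; auto.
Qed.

(** From [1 - v <= exp (- v)] follows [exp v * (1 - v) <= 1], and [1 / (1 - v) <= 1 + v + 2 v^2] for
    [v <= 1/2]. *)
Lemma exp_taylor1 (v : R) : v <= / 2 -> 0 <= exp v - 1 - v <= 2 * (v * v).
Proof.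
  intros Hv.
  assert (E : forall u, 1 + u <= exp u).
  { intros u. destruct (Req_dec u 0) as [->|N].
    - rewrite exp_0; lra.
    - left; now apply exp_ineq1. }
  pose proof (E v). pose proof (E (- v)). split; [lra|].
  assert (P : exp v * exp (- v) = 1) by (rewrite <- exp_plus, Rplus_opp_r; apply exp_0).
  pose proof (exp_pos v).
  assert (exp v * (1 - v) <= 1) by nra.
  nra.
Qed.

(** Differentiation under the integral sign: the bounds of [exp_taylor1] at [u * s], integrated
    against the tilted density, leave a remainder between 0 and [2 * (u * u) * Q]. *)
Lemma is_derive_moment (h : R -> R) (M : R) (j : nat) (t : R) :
  0 < M -> log_concave_on h 0 M ->
  is_derive (moment h M j) t (moment h M (S j) t).
Proof.
  intros HM Hh. apply is_derive_Reals. intros eps He.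
  set (Q := moment h M (S (S j)) t).
  assert (HQ : 0 <= Q).
  { apply (is_RInt_ge_0 _ 0 M) with (2 := is_RInt_moment h M (S (S j)) t HM Hh); [lra|].
    intros s Hs. apply Rmult_le_pos; [apply Rmult_le_pos|].
    - apply pow_le; lra.
    - left; apply exp_pos.
    - now apply cut_ge_0. }
  (* The first radius keeps [u * s <= 1/2]; the second makes [2 * Rabs u * Q] less than [eps], the
     added 1 keeping the denominator positive. *)
  assert (Hdel : 0 < Rmin (/ (2 * M)) (eps / (2 * Q + 1))).
  { apply Rmin_pos; [apply Rinv_0_lt_compat; lra|apply Rdiv_lt_0_compat; lra]. }
  exists (mkposreal _ Hdel). simpl. intros u Hu Hd.
  assert (Hd1 : Rabs u < / (2 * M)) by (eapply Rlt_le_trans; [exact Hd|apply Rmin_l]).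
  assert (Hd2 : Rabs u < eps / (2 * Q + 1)) by (eapply Rlt_le_trans; [exact Hd|apply Rmin_r]).
  assert (T : forall s, 0 < s < M ->
    0 <= exp (u * s) - 1 - u * s <= 2 * (u * s * (u * s))).
  { intros s Hs. apply exp_taylor1.
    apply Rle_trans with (Rabs u * s).
    - apply Rmult_le_compat_r; [lra|apply Rle_abs].
    - apply Rle_trans with (/ (2 * M) * M).
      + apply Rmult_le_compat; try lra. apply Rabs_pos.
      + right; field; lra. }
  assert (N : forall s, 0 < s < M -> 0 <= s ^ j * exp (t * s) * cut h 0 M s).
  { intros s Hs. apply Rmult_le_pos; [apply Rmult_le_pos|].
    - apply pow_le; lra.
    - left; apply exp_pos.
    - now apply cut_ge_0. }
  pose proof (is_RInt_moment h M j (t + u) HM Hh) as J1.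
  pose proof (is_RInt_moment h M j t HM Hh) as J2.
  pose proof (is_RInt_moment h M (S j) t HM Hh) as J3.
  pose proof (is_RInt_moment h M (S (S j)) t HM Hh) as J4. fold Q in J4.
  assert (X : forall s, exp ((t + u) * s) = exp (t * s) * exp (u * s)).
  { intros s; rewrite <- exp_plus; f_equal; ring. }
  assert (L : 0 <= 1 * moment h M j (t + u) + -1 * moment h M j t +
      - u * moment h M (S j) t + 0 * Q).
  { refine (lin4_ge_0 _ _ _ _ 0 M _ _ _ _ _ _ _ _ _ J1 J2 J3 J4 _); [lra|].
    intros s Hs. rewrite X. simpl pow.
    replace (_ + _) with (s ^ j * exp (t * s) * cut h 0 M s * (exp (u * s) - 1 - u * s)) by ring.
    apply Rmult_le_pos; [now apply N|]. now apply T. }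
  assert (U : 0 <= -1 * moment h M j (t + u) + 1 * moment h M j t +
      u * moment h M (S j) t + (2 * (u * u)) * Q).
  { refine (lin4_ge_0 _ _ _ _ 0 M _ _ _ _ _ _ _ _ _ J1 J2 J3 J4 _); [lra|].
    intros s Hs. rewrite X. simpl pow.
    replace (_ + _) with (s ^ j * exp (t * s) * cut h 0 M s *
      (2 * (u * s * (u * s)) - (exp (u * s) - 1 - u * s))) by ring.
    apply Rmult_le_pos; [now apply N|]. specialize (T s Hs); lra. }
  replace ((moment h M j (t + u) - moment h M j t) / u - moment h M (S j) t)
    with ((moment h M j (t + u) - moment h M j t - u * moment h M (S j) t) / u) by (field; auto).
  unfold Rdiv. rewrite Rabs_mult, Rabs_inv.
  assert (Pu : 0 < Rabs u) by now apply Rabs_pos_lt.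
  apply Rmult_lt_reg_r with (Rabs u); [assumption|].
  rewrite Rmult_assoc, Rinv_l, Rmult_1_r by lra.
  apply Rle_lt_trans with (2 * (u * u) * Q).
  - rewrite Rabs_pos_eq; lra.
  - replace (u * u) with (Rabs u * Rabs u) by (rewrite <- Rabs_mult; apply Rabs_pos_eq; nra).
    assert (Rabs u * (2 * Q + 1) < eps).
    { apply Rmult_lt_compat_r with (r := 2 * Q + 1) in Hd2; [|lra].
      replace (eps / (2 * Q + 1) * (2 * Q + 1)) with eps in Hd2 by (field; lra). exact Hd2. }
    nra.
Qed.

(** * The variance inequality *)

Section Variance.

Variables (M t : R) (alpha : R -> R).
Hypothesis HM : 1 < M.
Hypothesis Ha : log_concave_on alpha 0 M.

Let beta (s : R) : R := alpha s * binomR M s.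
Let m (j : nat) : R := moment beta M j t.
Let w (s : R) : R := exp (t * s) * cut beta 0 M s.
Let nu (s : R) : R := s * (M - s) * binomR M s * exp (t * s).
Let nuc : R -> R := cut nu 0 M.
Let alc : R -> R := cut alpha 0 M.

Lemma beta_log_concave : log_concave_on beta 0 M.
Proof. apply log_concave_mult; [exact Ha|apply binomR_log_concave]. Qed.

Let nu_log_concave : log_concave_on nu 0 M.
Proof.
  apply log_concave_mult; [|apply log_concave_exp].
  apply log_concave_mult; [|apply binomR_log_concave].
  apply log_concave_mult; [apply log_concave_id|apply log_concave_reflect]; lra.
Qed.

Let w_ge_0 (s : R) : 0 <= w s.
Proof.
  apply Rmult_le_pos; [left; apply exp_pos|]. apply cut_ge_0, beta_log_concave.
Qed.

Let quadratic_moment (p q r : R) :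
  is_RInt (fun s => (p + q * s + r * (s * s)) * w s) 0 M (p * m 0 + q * m 1 + r * m 2).
Proof.
  assert (HM0 : 0 < M) by lra.
  pose proof (is_RInt_moment beta M 0 t HM0 beta_log_concave) as J0.
  pose proof (is_RInt_moment beta M 1 t HM0 beta_log_concave) as J1.
  pose proof (is_RInt_moment beta M 2 t HM0 beta_log_concave) as J2.
  pose proof (is_RInt_lin4 _ _ _ _ 0 M p q r 0 _ _ _ _ J0 J1 J2 J0) as J.
  fold (m 0) (m 1) (m 2) in J. rewrite Rmult_0_l, Rplus_0_r in J.
  apply is_RInt_ext with (2 := J). intros s _. unfold w; simpl; ring.
Qed.

Let ex_RInt_quadratic (p q r a b : R) : a <= b ->
  ex_RInt (fun s => (p + q * s + r * (s * s)) * w s) a b.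
Proof.
  intros Hab.
  apply ex_RInt_ext with (fun s => (p + q * s + r * (s * s)) * exp (t * s) * cut beta 0 M s).
  { intros s _. unfold w; simpl; ring. }
  apply ex_RInt_log_concave; [assumption| |apply beta_log_concave]. intros x.
  apply (ex_derive_continuous (K := R_AbsRing) (V := R_NormedModule)). auto_derive; auto.
Qed.

(** The polynomials [s (s - 1)], [s (M - s)] and [(M - s) (M - s - 1)], expanded to the shape of
    [quadratic_moment]. *)
Let qA (s : R) : R := 0 + - 1 * s + 1 * (s * s).
Let qB (s : R) : R := 0 + M * s + - 1 * (s * s).
Let qC (s : R) : R := M * (M - 1) + - (2 * M - 1) * s + 1 * (s * s).
Let A : R := 0 * m 0 + - 1 * m 1 + 1 * m 2.
Let B : R := 0 * m 0 + M * m 1 + - 1 * m 2.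
Let C : R := M * (M - 1) * m 0 + - (2 * M - 1) * m 1 + 1 * m 2.
(** On [[0, M]], [qA] is nonpositive on [[0, 1]] and [qC] on [[M - 1, M]]; dropping these ranges can
    only increase the integrals. *)
Let Aplus : R := RInt (fun s => qA s * w s) 1 M.
Let Cplus : R := RInt (fun s => qC s * w s) 0 (M - 1).

Let int_Aplus : is_RInt (fun s => qA s * w s) 1 M Aplus.
Proof. apply (RInt_correct (V := R_CompleteNormedModule)), ex_RInt_quadratic; lra. Qed.

Let int_Cplus : is_RInt (fun s => qC s * w s) 0 (M - 1) Cplus.
Proof. apply (RInt_correct (V := R_CompleteNormedModule)), ex_RInt_quadratic; lra. Qed.

Let A_le_Aplus : A <= Aplus.
Proof.
  pose proof (RInt_correct (V := R_CompleteNormedModule) _ _ _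
    (ex_RInt_quadratic 0 (- 1) 1 0 1 ltac:(lra))) as J.
  pose proof (is_RInt_Chasles (V := R_NormedModule) _ _ _ _ _ _ J int_Aplus) as J'.
  pose proof (eq_trans
    (eq_sym (is_RInt_unique (V := R_CompleteNormedModule) _ _ _ _ (quadratic_moment 0 (- 1) 1)))
    (is_RInt_unique (V := R_CompleteNormedModule) _ _ _ _ J')) as E.
  fold A in E. rewrite E.
  assert (K : 0 <= - 1 * RInt (fun s => (0 + - 1 * s + 1 * (s * s)) * w s) 0 1).
  { apply (is_RInt_ge_0 _ 0 1) with (2 := is_RInt_scalR _ _ _ (- 1) _ J); [lra|].
    intros s Hs. pose proof (w_ge_0 s). assert (0 <= s * (1 - s) * w s); [|nra].
    apply Rmult_le_pos; [nra|assumption]. }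
  unfold plus; simpl. lra.
Qed.

Let C_le_Cplus : C <= Cplus.
Proof.
  pose proof (RInt_correct (V := R_CompleteNormedModule) _ _ _
    (ex_RInt_quadratic (M * (M - 1)) (- (2 * M - 1)) 1 (M - 1) M ltac:(lra))) as J.
  pose proof (is_RInt_Chasles (V := R_NormedModule) _ _ _ _ _ _ int_Cplus J) as J'.
  pose proof (eq_trans
    (eq_sym (is_RInt_unique (V := R_CompleteNormedModule) _ _ _ _
      (quadratic_moment (M * (M - 1)) (- (2 * M - 1)) 1)))
    (is_RInt_unique (V := R_CompleteNormedModule) _ _ _ _ J')) as E.
  fold C in E. rewrite E.
  assert (K : 0 <= - 1 * RInt (fun s => (M * (M - 1) + - (2 * M - 1) * s + 1 * (s * s)) * w s)
    (M - 1) M).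
  { apply (is_RInt_ge_0 _ (M - 1) M) with (2 := is_RInt_scalR _ _ _ (- 1) _ J); [lra|].
    intros s Hs. pose proof (w_ge_0 s). assert (0 <= (M - s) * (1 - (M - s)) * w s); [|nra].
    apply Rmult_le_pos; [nra|assumption]. }
  unfold plus; simpl. lra.
Qed.

(* Uses [s (1 - s) <= s (M - s)]. *)
Let opp_A_le_B : - A <= B.
Proof.
  enough (0 <= 0 * m 0 + (M - 1) * m 1 + 0 * m 2) by (unfold A, B; lra).
  apply (is_RInt_ge_0 _ 0 M) with (2 := quadratic_moment 0 (M - 1) 0); [lra|].
  intros s Hs. apply Rmult_le_pos; [nra|apply w_ge_0].
Qed.

(** The mirror image under [s -> M - s]: [B + C] is [M - 1] times the integral of
    [(M - s) * w s]. *)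
Let opp_C_le_B : - C <= B.
Proof.
  enough (0 <= M * (M - 1) * m 0 + - (M - 1) * m 1 + 0 * m 2) by (unfold C, B; lra).
  apply (is_RInt_ge_0 _ 0 M) with (2 := quadratic_moment (M * (M - 1)) (- (M - 1)) 0); [lra|].
  intros s Hs. apply Rmult_le_pos; [nra|apply w_ge_0].
Qed.

Let nuc_alc (y : R) : nuc y * alc y = qB y * w y.
Proof.
  unfold nuc, alc, w, qB. destruct (Rlt_dec 0 y) as [P|N].
  - destruct (Rlt_dec y M) as [P'|N'].
    + rewrite !cut_in by lra. unfold nu, beta. ring.
    + rewrite !cut_out by lra. ring.
  - rewrite !cut_out by lra. ring.
Qed.

Let int_nuc_alc : is_RInt (fun y => nuc y * alc y) 0 M B.
Proof.
  apply is_RInt_ext with (2 := quadratic_moment 0 M (- 1)).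
  intros y _. symmetry. apply nuc_alc.
Qed.

(* The recurrence of the binomial coefficient turns the shifted products of [nu] and [alpha]
   back into moments of [beta]. *)
Let int_nuc_alc_shift :
  is_RInt (fun y => nuc y * alc (y - 1)) 0 (M + 1) (exp t * Cplus).
Proof.
  apply is_RInt_zero_ends with 1 M; [lra|lra| | |].
  - intros y Hy. unfold alc. rewrite (cut_out alpha) by lra. ring.
  - intros y Hy. unfold nuc. rewrite (cut_out nu) by lra. ring.
  - pose proof (is_RInt_scalR _ _ _ (exp t) _ (is_RInt_shift1 _ _ _ _ int_Cplus)) as J.
    replace (0 + 1) with 1 in J by ring. replace (M - 1 + 1) with M in J by ring.
    apply is_RInt_ext with (2 := J).
    intros y Hy. rewrite Rmin_left, Rmax_right in Hy by lra.
    unfold nuc, alc, w, qC. rewrite !cut_in by lra. unfold nu, beta.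
    pose proof (binomR_shift M (y - 1) ltac:(lra)) as E.
    replace (y - 1 + 1) with y in E by ring.
    replace (exp (t * y)) with (exp t * exp (t * (y - 1)))
      by (rewrite <- exp_plus; f_equal; ring).
    replace (y * (M - y) * binomR M y) with ((M - y) * (y * binomR M y)) by ring.
    rewrite E. simpl; ring.
Qed.

(** Here [alc] keeps its argument, so the recurrence alone turns
    [(y - 1) (M - (y - 1)) binomR M (y - 1)] into [qA y * binomR M y]. *)
Let int_nuc_shift_alc :
  is_RInt (fun y => nuc (y - 1) * alc y) 0 (M + 1) (exp (- t) * Aplus).
Proof.
  apply is_RInt_zero_ends with 1 M; [lra|lra| | |].
  - intros y Hy. unfold nuc. rewrite (cut_out nu) by lra. ring.
  - intros y Hy. unfold alc. rewrite (cut_out alpha) by lra. ring.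
  - pose proof (is_RInt_scalR _ _ _ (exp (- t)) _ int_Aplus) as J.
    apply is_RInt_ext with (2 := J).
    intros y Hy. rewrite Rmin_left, Rmax_right in Hy by lra.
    unfold nuc, alc, w, qA. rewrite !cut_in by lra. unfold nu, beta.
    pose proof (binomR_shift M (y - 1) ltac:(lra)) as E.
    replace (y - 1 + 1) with y in E by ring.
    replace (exp (t * (y - 1))) with (exp (- t) * exp (t * y))
      by (rewrite <- exp_plus; f_equal; ring).
    replace ((y - 1) * (M - (y - 1)) * binomR M (y - 1))
      with ((y - 1) * ((M - (y - 1)) * binomR M (y - 1))) by ring.
    rewrite <- E. simpl; ring.
Qed.

(* The convolution of the log-concave functions [nu] and [alpha] is log-concave, at the
   points -1, 0, 1: the basic composition formula writes the difference of the two sides as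
   a double integral of a product of two minors of equal sign. *)
Let Aplus_Cplus_le : Aplus * Cplus <= B * B.
Proof.
  assert (H : exp t * Cplus * (exp (- t) * Aplus) <= B * B).
  { apply (iterated_RInt_ge_0 (fun y => nuc y * alc y) (fun y => nuc y * alc (y - 1))
      (fun y => nuc (y - 1) * alc y) (fun y => nuc (y - 1) * alc (y - 1)) 0 (M + 1)).
    - lra.
    - apply is_RInt_zero_ends with 0 M; [lra|lra|intros; lra| |exact int_nuc_alc].
      intros y Hy. unfold nuc. rewrite cut_out by lra. ring.
    - exact int_nuc_alc_shift.
    - exact int_nuc_shift_alc.
    - apply is_RInt_zero_ends with 1 (M + 1); [lra|lra| |intros; lra|].
      + intros y Hy. unfold nuc. rewrite cut_out by lra. ring.
      + replace 1 with (0 + 1) at 1 by ring. exact (is_RInt_shift1 _ _ _ _ int_nuc_alc).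
    (* Swapping [y] and [y'] changes the sign of both minors and preserves their product, so the
       case [y <= y'] suffices. *)
    - assert (K : forall y y', y <= y' ->
        0 <= (nuc y * nuc (y' - 1) - nuc y' * nuc (y - 1)) *
             (alc y * alc (y' - 1) - alc y' * alc (y - 1))).
      { intros y y' Hy.
        pose proof (cut_shift_minor nu 0 M y y' nu_log_concave Hy).
        pose proof (cut_shift_minor alpha 0 M y y' Ha Hy).
        apply Rmult_le_pos; unfold nuc, alc; lra. }
      intros y y'. destruct (Rle_lt_dec y y') as [L|L].
      + specialize (K y y' L). lra.
      + specialize (K y' y ltac:(lra)). lra. }
  replace (exp t * Cplus * (exp (- t) * Aplus))
    with (exp t * exp (- t) * (Aplus * Cplus)) in H by ring.
  rewrite <- exp_plus, Rplus_opp_r, exp_0, Rmult_1_l in H. exact H.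
Qed.

(** [B * B - A * C] equals [M - 1] times the right side minus the left side. *)
Lemma moment_variance : M * m 0 * (m 2 - m 1) <= (M - 1) * (m 1 * m 1).
Proof.
  assert (H : A * C <= B * B).
  { pose proof A_le_Aplus; pose proof C_le_Cplus; pose proof opp_A_le_B;
      pose proof opp_C_le_B; pose proof Aplus_Cplus_le.
    (* Opposite signs make [A * C] nonpositive; two nonpositive values use [- A <= B] and
       [- C <= B]; two positive ones use [A * C <= Aplus * Cplus]. *)
    destruct (Rle_lt_dec A 0); destruct (Rle_lt_dec C 0); nra. }
  unfold A, B, C in H. nra.
Qed.

End Variance.

(** On [[0, M]] two exponential tilts are comparable up to the positive constant [c]. *)
Lemma moment_pos (h : R -> R) (M t t' : R) :
  0 < M -> log_concave_on h 0 M -> 0 < moment h M 0 t -> 0 < moment h M 0 t'.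
Proof.
  intros HM Hh H.
  pose proof (is_RInt_moment h M 0 t HM Hh) as J.
  pose proof (is_RInt_moment h M 0 t' HM Hh) as J'.
  set (c := exp (- (Rabs (t' - t) * M))).
  assert (L : 0 <= 1 * moment h M 0 t' + - c * moment h M 0 t + 0 * moment h M 0 t +
    0 * moment h M 0 t).
  { refine (lin4_ge_0 _ _ _ _ 0 M _ _ _ _ _ _ _ _ _ J' J J J _); [lra|].
    intros s Hs. pose proof (cut_ge_0 h 0 M s Hh).
    assert (c * exp (t * s) <= exp (t' * s)).
    { unfold c. rewrite <- exp_plus.
      enough (- (Rabs (t' - t) * M) + t * s <= t' * s) as [K|K].
      - left; now apply exp_increasing.
      - rewrite K; lra.
      - pose proof (Rle_abs (- (t' - t))) as K. rewrite Rabs_Ropp in K.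
        pose proof (Rabs_pos (t' - t)). nra. }
    simpl pow.
    replace (_ + _) with ((exp (t' * s) - c * exp (t * s)) * cut h 0 M s) by ring.
    apply Rmult_le_pos; lra. }
  assert (0 < c) by apply exp_pos.
  assert (0 < c * moment h M 0 t) by now apply Rmult_lt_0_compat.
  lra.
Qed.

(** * Log-concavity of the Bernstein-type integral *)

(** With [z] the intermediate point, mean values [F1 c1] on [[x, z]] and [F1 c2] on [[z, y]] are
    compared by a third mean value, of [F2]. *)
Lemma concave_of_second_derivative (F F1 F2 : R -> R) (a b : R) :
  (forall x, a < x < b -> is_derive F x (F1 x)) ->
  (forall x, a < x < b -> is_derive F1 x (F2 x)) ->
  (forall x, a < x < b -> F2 x <= 0) ->
  forall x y lam, a < x < b -> a < y < b -> 0 < lam < 1 ->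
  lam * F x + (1 - lam) * F y <= F (lam * x + (1 - lam) * y).
Proof.
  intros D1 D2 N.
  assert (MV : forall G G', (forall x, a < x < b -> is_derive G x (G' x)) ->
    forall u v, a < u < b -> a < v < b -> u <= v ->
    exists c, u <= c <= v /\ G v - G u = G' c * (v - u)).
  { intros G G' DG u v Hu Hv Huv.
    destruct (MVT_gen G u v G') as (c & Hc & E).
    - intros x Hx. rewrite Rmin_left, Rmax_right in Hx by lra. apply DG; lra.
    - intros x Hx. rewrite Rmin_left, Rmax_right in Hx by lra.
      apply continuity_pt_filterlim.
      apply (ex_derive_continuous (K := R_AbsRing) (V := R_NormedModule)).
      exists (G' x). apply DG; lra.
    - rewrite Rmin_left, Rmax_right in Hc by lra. exists c; split; assumption. }
  assert (W : forall x y lam, a < x < b -> a < y < b -> 0 < lam < 1 -> x <= y ->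
    lam * F x + (1 - lam) * F y <= F (lam * x + (1 - lam) * y)).
  { intros x y lam Hx Hy Hl Hxy. set (z := lam * x + (1 - lam) * y).
    assert (Hz : x <= z <= y) by (unfold z; nra).
    destruct (MV F F1 D1 x z) as (c1 & Hc1 & E1); [lra..|].
    destruct (MV F F1 D1 z y) as (c2 & Hc2 & E2); [lra..|].
    destruct (MV F1 F2 D2 c1 c2) as (c3 & Hc3 & E3); [lra..|].
    specialize (N c3 ltac:(lra)).
    assert (F1 c2 <= F1 c1) by nra.
    replace (z - x) with ((1 - lam) * (y - x)) in E1 by (unfold z; ring).
    replace (y - z) with (lam * (y - x)) in E2 by (unfold z; ring).
    assert (0 <= lam * (1 - lam) * (y - x) * (F1 c1 - F1 c2)).
    { apply Rmult_le_pos; [|lra]. apply Rmult_le_pos; [nra|lra]. }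
    replace (F x) with (F z - F1 c1 * ((1 - lam) * (y - x))) by lra.
    replace (F y) with (F z + F1 c2 * (lam * (y - x))) by lra.
    lra. }
  intros x y lam Hx Hy Hl. destruct (Rle_lt_dec x y) as [L|L]; [now apply W|].
  specialize (W y x (1 - lam) Hy Hx ltac:(lra) ltac:(lra)).
  replace (1 - (1 - lam)) with lam in W by ring.
  rewrite (Rplus_comm (lam * x)). lra.
Qed.

(** The substitution [t = ln (1 - x) - ln x] turns [(1 - x)^s x^(M - s)] into [x^M exp (t s)]. *)
Lemma integrand_moment (M : R) (alpha : R -> R) (x s : R) :
  0 < x < 1 -> 0 < s < M ->
  Rpower x M * (s ^ 0 * exp ((ln (1 - x) - ln x) * s) *
    cut (fun s => alpha s * binomR M s) 0 M s) = integrand alpha M x s.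
Proof.
  intros Hx Hs. unfold integrand. rewrite cut_in, !rpow_pos by lra. unfold Rpower.
  replace (s * ln (1 - x)) with ((ln (1 - x) - ln x) * s + s * ln x) by ring.
  replace (M * ln x) with ((M - s) * ln x + s * ln x) by ring.
  rewrite !exp_plus. simpl. ring.
Qed.

Lemma is_RInt_integrand (M : R) (alpha : R -> R) (x : R) :
  0 < M -> log_concave_on alpha 0 M -> 0 < x < 1 ->
  is_RInt (integrand alpha M x) 0 M
    (Rpower x M * moment (fun s => alpha s * binomR M s) M 0 (ln (1 - x) - ln x)).
Proof.
  intros HM Ha Hx.
  apply is_RInt_ext with (2 := is_RInt_scalR _ _ _ (Rpower x M) _
    (is_RInt_moment _ M 0 (ln (1 - x) - ln x) HM (beta_log_concave M alpha Ha))).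
  intros s Hs. rewrite Rmin_left, Rmax_right in Hs by lra. now apply integrand_moment.
Qed.

Theorem theorem1 (M : R) (alpha : R -> R) :
  1 < M ->
  (forall s, 0 < s < M -> 0 <= alpha s) ->
  log_concave_on alpha 0 M ->
  (forall x, 0 < x < 1 -> inhabited (Riemann_integrable (integrand alpha M x) 0 M)) /\
  log_concave_on (fM alpha M) 0 1.
Proof.
  intros HM _ Ha. assert (HM0 : 0 < M) by lra.
  split.
  (* Integrability ensures that [Rint] in [fM] is the genuine integral and not its default 0. *)
  { intros x Hx. constructor. apply ex_RInt_Reals_0.
    eexists. now apply is_RInt_integrand. }
  set (beta := fun s => alpha s * binomR M s).
  assert (Hb : log_concave_on beta 0 M) by (apply (beta_log_concave M alpha Ha)).
  set (m := moment beta M). set (T := fun x => ln (1 - x) - ln x).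
  assert (Ef : forall x, 0 < x < 1 -> fM alpha M x = Rpower x M * m 0%nat (T x)).
  { intros x Hx. pose proof (is_RInt_integrand M alpha x HM0 Ha Hx) as J.
    unfold fM. rewrite Rint_RInt by (eexists; exact J).
    exact (is_RInt_unique (V := R_CompleteNormedModule) _ _ _ _ J). }
  assert (P0 : forall t, 0 <= m 0%nat t).
  { intros t. apply (is_RInt_ge_0 _ 0 M) with (2 := is_RInt_moment beta M 0 t HM0 Hb); [lra|].
    intros s Hs. apply Rmult_le_pos; [|now apply cut_ge_0].
    simpl. pose proof (exp_pos (t * s)). lra. }
  apply log_concave_intro.
  { intros x Hx. rewrite Ef by assumption.
    apply Rmult_le_pos; [left; apply Rpower_gt_0|apply P0]. }
  intros x0 y0 lam Hx0 Hy0 Hl Px0 _.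
  (* Positivity of the integral at [x0] spreads to every tilt, so the logarithm [F] is meaningful on
     all of [(0, 1)]. *)
  assert (Pm : forall t, 0 < m 0%nat t).
  { rewrite Ef in Px0 by assumption. pose proof (Rpower_gt_0 x0 M).
    intros t. apply (moment_pos beta M (T x0) t HM0 Hb).
    fold (m 0%nat (T x0)). specialize (P0 (T x0)). nra. }
  set (F := fun x => M * ln x + ln (m 0%nat (T x))).
  assert (EF : forall x, 0 < x < 1 -> fM alpha M x = exp (F x)).
  { intros x Hx. rewrite Ef by assumption. unfold F, Rpower.
    rewrite exp_plus, exp_ln by apply Pm. reflexivity. }
  assert (Hz0 : 0 < lam * x0 + (1 - lam) * y0 < 1) by nra.
  rewrite !EF by assumption. unfold Rpower. rewrite !ln_exp, <- exp_plus.
  enough (lam * F x0 + (1 - lam) * F y0 <= F (lam * x0 + (1 - lam) * y0)) as [K|K].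
  { left; now apply exp_increasing. }
  { rewrite K; lra. }
  (* [L] and [L1] are the mean and the variance of the tilted density; [L1] is the derivative of
     [L]. *)
  set (L := fun t => m 1%nat t / m 0%nat t).
  set (L1 := fun t => (m 2%nat t * m 0%nat t - m 1%nat t * m 1%nat t) / (m 0%nat t * m 0%nat t)).
  apply (concave_of_second_derivative F
    (fun x => M / x - L (T x) / (x * (1 - x)))
    (fun x => - M / (x * x) + L1 (T x) / (x * x * ((1 - x) * (1 - x))) +
       L (T x) * (1 - 2 * x) / (x * x * ((1 - x) * (1 - x)))) 0 1); auto.
  - intros x Hx.
    assert (D0 : is_derive (m 0%nat) (T x) (m 1%nat (T x))) by now apply is_derive_moment.
    assert (DT : is_derive T x (- / (x * (1 - x)))).
    { unfold T. auto_derive; [lra|]. field; lra. }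
    pose proof (is_derive_comp _ _ _ _ _ D0 DT) as D1.
    unfold F. unfold L.
    assert (Dx : derivable_pt_lim ln (m 0%nat (T x)) (/ m 0%nat (T x)))
      by (apply derivable_pt_lim_ln, Pm).
    apply is_derive_Reals in Dx.
    pose proof (is_derive_comp ln (fun u => m 0%nat (T u)) x _ _ Dx D1) as D2.
    assert (D3 : is_derive (fun x => M * ln x) x (M / x)) by (auto_derive; [lra|field; lra]).
    refine (eq_rect _ (is_derive _ x) (is_derive_plus _ _ _ _ _ D3 D2) _ _).
    unfold plus, scal; simpl; unfold mult; simpl. specialize (Pm (T x)).
    field; repeat split; lra.
  - intros x Hx.
    assert (D0 : is_derive (m 0%nat) (T x) (m 1%nat (T x))) by now apply is_derive_moment.
    assert (D1 : is_derive (m 1%nat) (T x) (m 2%nat (T x))) by now apply is_derive_moment.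
    assert (DT : is_derive T x (- / (x * (1 - x)))).
    { unfold T. auto_derive; [lra|]. field; lra. }
    pose proof (Pm (T x)) as PmT.
    pose proof (is_derive_comp L T x _ _ (is_derive_div _ _ _ _ _ D1 D0 ltac:(lra)) DT) as DL.
    assert (D2 : is_derive (fun x => / (x * (1 - x))) x
      (- (1 - 2 * x) / (x * x * ((1 - x) * (1 - x))))).
    { auto_derive; [nra|]. field; lra. }
    assert (D3 : is_derive (fun x => M / x) x (- M / (x * x))).
    { auto_derive; [lra|]. field; lra. }
    refine (eq_rect _ (is_derive _ x) (is_derive_minus _ _ _ _ _ D3
      (is_derive_mult _ _ _ _ _ DL D2 Rmult_comm)) _ _).
    unfold minus, plus, opp, scal, mult; simpl; unfold mult, plus; simpl.
    unfold L, L1. field; repeat split; lra.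
  - intros x Hx. specialize (Pm (T x)).
    pose proof (moment_variance M (T x) alpha HM Ha) as V.
    fold beta in V. fold m in V.
    (* The bound of [moment_variance], rewritten for the normalised density. *)
    assert (E : L1 (T x) <= L (T x) - L (T x) * L (T x) / M).
    { unfold L, L1. set (a0 := m 0%nat (T x)) in *. set (a1 := m 1%nat (T x)) in *.
      set (a2 := m 2%nat (T x)) in *.
      apply Rmult_le_reg_r with (M * (a0 * a0)); [apply Rmult_lt_0_compat; nra|].
      replace ((a2 * a0 - a1 * a1) / (a0 * a0) * (M * (a0 * a0)))
        with (M * (a2 * a0 - a1 * a1)) by (field; lra).
      replace ((a1 / a0 - a1 / a0 * (a1 / a0) / M) * (M * (a0 * a0)))
        with (M * a1 * a0 - a1 * a1) by (field; lra).
      lra. }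
    set (l := L (T x)) in *. set (l1 := L1 (T x)) in *.
    replace (- M / (x * x) + l1 / (x * x * ((1 - x) * (1 - x))) +
       l * (1 - 2 * x) / (x * x * ((1 - x) * (1 - x))))
      with (- ((M * ((1 - x) * (1 - x)) - l1 - l * (1 - 2 * x)) /
        (x * x * ((1 - x) * (1 - x))))) by (field; lra).
    enough (0 <= (M * ((1 - x) * (1 - x)) - l1 - l * (1 - 2 * x)) /
        (x * x * ((1 - x) * (1 - x)))) by lra.
    apply Rdiv_le_0_compat.
    (* After the variance bound, what remains of the numerator is a perfect square divided by
       [M]. *)
    + assert (S : 0 <= (M * (1 - x) - l) * (M * (1 - x) - l) / M)
        by (apply Rdiv_le_0_compat; [apply Rle_0_sqr|lra]).
      replace ((M * (1 - x) - l) * (M * (1 - x) - l) / M)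
        with (M * ((1 - x) * (1 - x)) - l * (1 - 2 * x) - (l - l * l / M)) in S
        by (field; lra).
      lra.
    + apply Rmult_lt_0_compat; nra.
Qed.
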